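(* Let $d=2^n$ and $m\ge1$. For $n$-qubit Pauli operators $A_1,B_1,\dots,A_m,B_m$ define $$\mathrm{OTO}^{(4m)}(A_1,B_1,\dots,A_m,B_m)=\big\langle A_1\tilde B_1\cdots A_m\tilde B_m\;A_m^\dagger\tilde B_{m-1}^\dagger A_{m-1}^\dagger\cdots\tilde B_1^\dagger A_1^\dagger\;\tilde B_m^\dagger\big\rangle_{\mathrm{Haar}} .$$ Then the average of $\mathrm{OTO}^{(4m)}(A_1,B_1,\dots,A_m,B_m)$ over all choices of Pauli operators subject to $B_1,\dots,B_m\ne I$ and $A_1A_2\cdots A_m\not\propto I$ equals $$\left(\frac{-1}{d^2-1}\right)^m .$$
   Context: $n$-qubit Pauli operators are the $4^n=d^2$ operators $P_1\otimes\cdots\otimes P_n$ with each $P_j\in\{I,X,Y,Z\}$ (no global phases). $\tilde B=U^\dagger BU$ and $\langle\,\cdot\,\rangle_{\mathrm{Haar}}=\int_{\mathrm{Haar}}dU\,\frac1d\mathrm{tr}\{\,\cdot\,\}$ with $dU$ the Haar probability measure on $U(d)$. For $m=1$ the correlator is $\langle A_1\tilde B_1A_1^\dagger\tilde B_1^\dagger\rangle_{\mathrm{Haar}}$; for $m=2$ it is $\langle A_1\tilde B_1A_2\tilde B_2A_2^\dagger\tilde B_1^\dagger A_1^\dagger\tilde B_2^\dagger\rangle_{\mathrm{Haar}}$. *)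

(* Defs.v *)
From HB Require Import structures.
From mathcomp Require Import all_boot all_order all_algebra.
From mathcomp Require Import mxtens complex.
From mathcomp Require Import all_classical all_reals all_analysis.

Set Implicit Arguments.
Unset Strict Implicit.
Unset Printing Implicit Defensive.

Import Order.TTheory GRing.Theory Num.Theory.
Import numFieldNormedType.Exports.

Local Open Scope classical_set_scope.
Local Open Scope ring_scope.
Local Open Scope complex_scope.
Local Open Scope sesquilinear_scope.

Definition unitary (R : realType) (d : nat) : Type :=
  {U : 'M[R[i]]_d | U \is unitarymx}.

HB.instance Definition _ (R : realType) (d : nat) :=
  Choice.copy (unitary R d) {U : 'M[R[i]]_d | U \is unitarymx}.

Fact unitary1_subproof (R : realType) (d : nat) :
  (1%:M : 'M[R[i]]_d) \is unitarymx.
Proof. by apply/unitarymxP; rewrite trmx1 map_mx1 mulmx1. Qed.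

HB.instance Definition _ (R : realType) (d : nat) :=
  isPointed.Build (unitary R d) (exist _ 1%:M (unitary1_subproof R d)).

Definition unitary_mul (R : realType) (d : nat) (V U : unitary R d) :
  unitary R d :=
  exist _ (sval V *m sval U) (mul_unitarymx (svalP V) (svalP U)).

(* The regular module R[i]^o is where the library puts the metric topology of *)
(* the field R[i].                                                            *)
Definition unitary_mx (R : realType) (d : nat) (U : unitary R d) :
  'M[R[i]^o]_d := sval U.

Definition unitary_open (R : realType) (d : nat) : set (set (unitary R d)) :=
  @open (initial_topology (@unitary_mx R d)).

Definition unitary_borel (R : realType) (d : nat) :=
  g_sigma_algebraType (@unitary_open R d).

(* A left-invariant Borel probability measure on the compact group U(d); it   *)
(* exists and is unique.                                                      *)
Definition is_haar (R : realType) (d : nat)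
    (mu : probability (unitary_borel R d) R) : Prop :=
  forall (V : unitary R d) (S : set (unitary_borel R d)),
    measurable S -> mu (unitary_mul V @^-1` S) = mu S.

Definition complex_integral (R : realType) (d : nat)
    (mu : probability (unitary_borel R d) R) (f : unitary R d -> R[i]) : R[i] :=
  Rintegral mu setT (fun U => complex.Re (f U))
    +i* Rintegral mu setT (fun U => complex.Im (f U)).

Definition haar_avg (R : realType) (d : nat)
    (mu : probability (unitary_borel R d) R) (F : unitary R d -> 'M[R[i]]_d) :
    R[i] :=
  complex_integral mu (fun U => d%:R^-1 * \tr (F U)).

Definition evolve (R : realType) (d : nat) (U : unitary R d) (B : 'M[R[i]]_d) :
  'M[R[i]]_d := (sval U)^t* *m B *m sval U.

Section Pauli.
Variable R : realType.

Definition pauliX : 'M[R[i]]_2 := \matrix_(i, j) (i != j)%:R.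
Definition pauliY : 'M[R[i]]_2 :=
  \matrix_(i, j)
    (if (i < j)%N then 0 -i* 1 else if (j < i)%N then 0 +i* 1 else 0).
Definition pauliZ : 'M[R[i]]_2 := \matrix_(i, j) ((-1) ^+ i *+ (i == j)).

Definition pauli1 (k : 'I_4) : 'M[R[i]]_2 :=
  tnth [tuple 1%:M; pauliX; pauliY; pauliZ] k.

Fixpoint tensor (n : nat) : ('I_n -> 'M[R[i]]_2) -> 'M[R[i]]_(2 ^ n) :=
  match n with
  | 0 => fun _ => 1%:M
  | n'.+1 => fun M =>
      castmx (esym (expnS 2 n'), esym (expnS 2 n'))
        (M ord0 *t tensor (fun j : 'I_n' => M (lift ord0 j)))
  end.

(* P_1 (x) ... (x) P_n; the 4 ^ n labels give pairwise distinct operators, so *)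
(* averaging over labels is averaging over Pauli operators.                   *)
Definition pauli (n : nat) (p : {ffun 'I_n -> 'I_4}) : 'M[R[i]]_(2 ^ n) :=
  tensor (fun j => pauli1 (p j)).

End Pauli.

(* With M = m.+1 >= 1 the number of pairs (A_j, B_j), indexed from 0:         *)
(*   A_0 B~_0 ... A_m B~_m                                                    *)
(*     A_m^* (B~_(m-1)^* A_(m-1)^* ) ... (B~_0^* A_0^* ) B~_m^*               *)
Definition oto_word (R : realType) (d m : nat) (A B : 'I_m.+1 -> 'M[R[i]]_d)
    (U : unitary R d) : 'M[R[i]]_d :=
  let Bt j := evolve U (B j) in
  (\prod_(j < m.+1) (A j *m Bt j))
  *m (A ord_max)^t*
  *m (\prod_(j < m) (let k := widen_ord (leqnSn m) (rev_ord j) in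
                     (Bt k)^t* *m (A k)^t*))
  *m (Bt ord_max)^t*.

Definition OTO (R : realType) (d m : nat)
    (mu : probability (unitary_borel R d) R) (A B : 'I_m.+1 -> 'M[R[i]]_d) :
    R[i] :=
  haar_avg mu (oto_word A B).

(* AB.1 lists the A_j and AB.2 lists the B_j.                                  *)
Definition pauli_choice (n M : nat) : finType :=
  ({ffun 'I_M -> {ffun 'I_n -> 'I_4}} * {ffun 'I_M -> {ffun 'I_n -> 'I_4}})%type.

Definition admissible (R : realType) (n M : nat) : {set pauli_choice n M} :=
  [set AB : pauli_choice n M |
     [forall j, pauli R (AB.2 j) != 1%:M]
     && ~~ is_scalar_mx (\prod_(j < M) pauli R (AB.1 j))].

Definition average (K : fieldType) (T : finType) (S : {set T}) (f : T -> K) : K :=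
  (\sum_(x in S) f x) / #|S|%:R.

(* Main.v *)
Require Import Defs.
From HB Require Import structures.
From mathcomp Require Import all_boot all_order all_algebra.
From mathcomp Require Import mxtens complex.
From mathcomp Require Import all_classical all_reals all_analysis.
From mathcomp Require Import measurable_realfun.

Set Implicit Arguments.
Unset Strict Implicit.
Unset Printing Implicit Defensive.

Import Order.TTheory GRing.Theory Num.Theory.
Import numFieldNormedType.Exports.
Local Open Scope ring_scope.
Local Open Scope sesquilinear_scope.

(** The identity already holds for every fixed unitary U, before integrating.
    Write E for the Pauli basis, F := U^* E U for the evolved one, q := d^2, and for the first k pairs
    put Y := A_1 B~_1 ... A_k B~_k and P := A_1 ... A_k. Twirling over A_m kills
    the sum over all A's, so only minus the sum over A_1 ... A_m ~ I remains;
    there A_m is P^* up to a phase, and twirling over B_m <> I leaves the sum of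
    |tr (Y P^* )|^2 - 1 over the first m - 1 pairs. The sum S_k of the overlaps
    |tr (Y P^* )|^2 is computed by Parseval over B_k:
    S_(k+1) = q (q N_k - S_k) with N_k = (q (q - 1))^k and S_0 = q. *)

(** * Averages over Hermitian operator bases *)

Section FfunSnoc.
Context (T : finType) (k : nat).

Definition ffun_snoc (g : {ffun 'I_k -> T}) (t : T) : {ffun 'I_k.+1 -> T} :=
  [ffun j => oapp g t (unlift ord_max j)].

Lemma ffun_snoc_widen g t (j : 'I_k) :
  ffun_snoc g t (widen_ord (leqnSn k) j) = g j.
Proof.
have -> : widen_ord (leqnSn k) j = lift ord_max j by apply/val_inj/esym/lift_max.
by rewrite ffunE liftK.
Qed.

Lemma ffun_snoc_max g t : ffun_snoc g t ord_max = t.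
Proof. by rewrite ffunE unlift_none. Qed.

Lemma forall_ffun_snoc (P : pred T) g t :
  [forall j, P (ffun_snoc g t j)] = [forall j, P (g j)] && P t.
Proof.
apply/forallP/andP => [h|[/forallP h Pt] j].
  split; last by rewrite -(ffun_snoc_max g t).
  by apply/forallP => j; rewrite -(ffun_snoc_widen g t).
by rewrite ffunE; case: unliftP => [j'|] _ //=.
Qed.

Lemma big_ffun_snoc (V : nmodType) (F : {ffun 'I_k.+1 -> T} -> V) :
  \sum_f F f = \sum_g \sum_t F (ffun_snoc g t).
Proof.
rewrite pair_big /= (reindex (fun x => ffun_snoc x.1 x.2)) //=.
exists (fun f : {ffun 'I_k.+1 -> T} => ([ffun j => f (widen_ord (leqnSn k) j)], f ord_max)).
  move=> [g t] _ /=; rewrite ffun_snoc_max; congr pair.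
  by apply/ffunP => j; rewrite ffunE ffun_snoc_widen.
move=> f _ /=; apply/ffunP => j; rewrite ffunE.
case: unliftP => [j'|] -> //=; rewrite ffunE; congr (f _).
exact/val_inj/esym/lift_max.
Qed.

Lemma big_ffun_snoc_cond (V : nmodType) (P : pred T) (F : {ffun 'I_k.+1 -> T} -> V) :
  \sum_(f : {ffun 'I_k.+1 -> T} | [forall j, P (f j)]) F f
  = \sum_(g : {ffun 'I_k -> T} | [forall j, P (g j)])
      \sum_(t | P t) F (ffun_snoc g t).
Proof.
rewrite big_mkcond big_ffun_snoc [RHS]big_mkcond; apply: eq_bigr => g _.
under eq_bigr do rewrite forall_ffun_snoc.
case: ifP => _ /=; last by rewrite big1.
by rewrite [RHS]big_mkcond.
Qed.

End FfunSnoc.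

(** * Adjoints and unitarity of matrix products *)

Section Adjoint.
Context (C : numClosedFieldType).

Lemma adjmx_mul p q r (M : 'M[C]_(p, q)) (N : 'M[C]_(q, r)) :
  (M *m N)^t* = N^t* *m M^t*.
Proof. by rewrite trmx_mul map_mxM. Qed.

Lemma mxtrace_adj n (M : 'M[C]_n) : \tr (M^t*) = (\tr M)^*.
Proof. by rewrite trace_map_mx mxtrace_tr. Qed.

Lemma unitarymx1 n : (1%:M : 'M[C]_n) \is unitarymx.
Proof. by apply/unitarymxP; rewrite trmx1 map_mx1 mulmx1. Qed.

Lemma prod_unitarymx n (I : Type) (s : seq I) (M : I -> 'M[C]_n) :
  (forall i, M i \is unitarymx) -> \prod_(i <- s) M i \is unitarymx.
Proof.
move=> uM; apply: (big_ind (fun X => X \is unitarymx)) => // [|X Y].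
  exact: unitarymx1.
exact: mul_unitarymx.
Qed.

(** Taking adjoints reverses a product; this identifies the descending half of the correlator with
    the adjoint of its ascending half. *)
Lemma prod_adjmx_rev n k (M : 'I_k -> 'M[C]_n) :
  \prod_(j < k) (M (rev_ord j))^t* = (\prod_(j < k) M j)^t*.
Proof.
elim: k M => [|k IH] M; first by rewrite !big_ord0 trmx1 map_mx1.
rewrite big_ord_recl big_ord_recr [RHS]adjmx_mul -IH.
have -> : rev_ord ord0 = ord_max :> 'I_k.+1 by apply: val_inj; rewrite /= subn1.
congr (_ *m _); apply: eq_bigr => j _.
have -> // : rev_ord (lift ord0 j) = widen_ord (leqnSn k) (rev_ord j).
exact: val_inj.
Qed.

End Adjoint.

(** * Completeness, twirling and Parseval for a Hermitian operator basis *)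

Section HermitianBasis.
Context (C : numClosedFieldType) (d : nat) (T : finType) (e : T).

(** Abstracts what the Pauli basis and its conjugate by U share, so that the twirl and Parseval
    apply to both. Orthogonality gives independence, and [hb_card] then makes the family span all
    matrices. *)
Record hermitian_basis (E : T -> 'M[C]_d) : Prop := HermitianBasis {
  hb_card : #|T| = (d * d)%N;
  hb_id : E e = 1%:M;
  hb_herm : forall p, (E p)^t* = E p;
  hb_inv : forall p, E p *m E p = 1%:M;
  hb_orth : forall p q, \tr (E p *m E q) = d%:R *+ (p == q) }.

Section Completeness.
Context (E : T -> 'M[C]_d) (hE : hermitian_basis E) (d_gt0 : (0 < d)%N).

Let d_neq0 : d%:R != 0 :> C. Proof. by rewrite pnatr_eq0 -lt0n. Qed.

Lemma hb_unitary p : E p \is unitarymx.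
Proof. by apply/unitarymxP; rewrite (hb_herm hE) (hb_inv hE). Qed.

Lemma hb_trace p : p != e -> \tr (E p) = 0.
Proof.
by move=> pe; rewrite -[E p]mulmx1 -(hb_id hE) (hb_orth hE) (negbTE pe).
Qed.

(* The matrix with the vectorized E p as rows is, up to sqrt d, an isometry;  *)
(* being square by hb_card it is also a co-isometry.                          *)
Lemma hb_complete i j k l :
  \sum_p E p i j * (E p k l)^* = d%:R *+ ((i == k) && (j == l)).
Proof.
pose lab (r : 'I_(d * d)) : T := enum_val (cast_ord (esym (hb_card hE)) r).
have lab_bij : bijective lab.
  exists (fun p => cast_ord (hb_card hE) (enum_rank p)) => x.
    by rewrite /lab enum_valK cast_ordKV.
  by rewrite /lab cast_ordK enum_rankK.
pose W : 'M[C]_(d * d) := \matrix_(r, s) mxvec (E (lab r)) 0 s.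
have WW : (d%:R^-1 *: W) *m W^t* = 1%:M.
  apply/matrixP => r r'; rewrite -scalemxAl !mxE.
  (* Rows of [W] pair to the Hilbert-Schmidt product of two basis elements; Hermiticity removes the
     adjoint. *)
  have -> : \sum_s W r s * W^t* s r' = \tr (E (lab r) *m E (lab r')).
    rewrite -[in RHS](hb_herm hE (lab r')).
    transitivity (\sum_a \sum_b W r (mxvec_index a b) * W^t* (mxvec_index a b) r').
      rewrite (reindex _ (curry_mxvec_bij d d)) pair_bigA /=.
      by apply: eq_bigr => -[a b].
    apply: eq_bigr => a _; rewrite mxE; apply: eq_bigr => b _.
    by rewrite !mxE !mxvecE.
  rewrite (hb_orth hE) (bij_eq lab_bij).
  by case: (r == r') => /=; rewrite ?mulr0 // mulVf.
have /matrixP/(_ (mxvec_index k l) (mxvec_index i j)) := mulmx1C WW.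
rewrite !mxE => /(congr1 (fun x => d%:R * x)).
rewrite mulr_sumr (reindex lab) /=; last exact: onW_bij.
move=> H; transitivity (d%:R * (mxvec_index k l == mxvec_index i j)%:R : C).
  rewrite -H; apply: eq_bigr => r _; rewrite !mxE !mxvecE.
  by rewrite mulrCA [X in _ = _ * X]mulrA divff // mul1r mulrC.
rewrite /mxvec_index (inj_eq (@cast_ord_inj _ _ _)) (inj_eq enum_rank_inj) xpair_eqE.
rewrite [k == i]eq_sym [l == j]eq_sym.
by case: andP; rewrite ?mulr1 ?mulr0.
Qed.

(** By Hermiticity [E p k l] is the conjugate of [E p l k], so completeness keeps only i = l and j =
    k in the sum of [E p i j * X j k * E p k l]. *)
Lemma hb_twirl X : \sum_p E p *m X *m E p = (d%:R * \tr X)%:M.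
Proof.
apply/matrixP => i l; rewrite summxE !mxE.
transitivity (\sum_k \sum_j X j k * (d%:R *+ ((i == l) && (j == k)))).
  under eq_bigr do rewrite mxE.
  rewrite exchange_big; apply: eq_bigr => k _ /=.
  under eq_bigr do rewrite mxE mulr_suml.
  rewrite exchange_big; apply: eq_bigr => j _ /=.
  rewrite -hb_complete mulr_sumr; apply: eq_bigr => p _.
  have -> : (E p l k)^* = E p k l by rewrite -[in RHS](hb_herm hE p) !mxE.
  by rewrite mulrAC mulrC.
rewrite mulrC /mxtrace mulr_suml; case: eqP => _ /=; last first.
  by rewrite mulr0n big1 // => k _; rewrite big1 // => j _; rewrite mulr0n mulr0.
apply: eq_bigr => k _; rewrite (bigD1 k) //= eqxx big1 ?addr0 // => j /negbTE ->.
by rewrite mulr0.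
Qed.

(** Expanding both traces and summing over [p] first, completeness identifies the two index pairs
    and leaves the squared Frobenius norm. *)
Lemma hb_parseval Z :
  \sum_p \tr (Z *m E p) * (\tr (Z *m E p))^* = d%:R * \tr (Z *m Z^t*).
Proof.
transitivity (\sum_i \sum_j \sum_k \sum_l
    Z i j * (Z k l)^* * (d%:R *+ ((j == l) && (i == k)))).
  under [RHS]eq_bigr do under eq_bigr do under eq_bigr do under eq_bigr do
    rewrite -hb_complete mulr_sumr.
  under [RHS]eq_bigr do under eq_bigr do under eq_bigr do rewrite exchange_big /=.
  under [RHS]eq_bigr do under eq_bigr do rewrite exchange_big /=.
  under [RHS]eq_bigr do rewrite exchange_big /=.
  rewrite exchange_big /=; apply: eq_bigr => p _.
  rewrite mulr_suml; apply: eq_bigr => i _.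
  rewrite mxE mulr_suml; apply: eq_bigr => j _.
  rewrite rmorph_sum mulr_sumr; apply: eq_bigr => k _.
  rewrite mxE rmorph_sum mulr_sumr; apply: eq_bigr => l _.
  by rewrite rmorphM mulrACA.
rewrite /mxtrace mulr_sumr; apply: eq_bigr => i _.
rewrite mxE mulr_sumr; apply: eq_bigr => j _; rewrite !mxE.
rewrite (bigD1 i) //= (bigD1 j) //= !eqxx /= mulr1n big1 => [|l /negbTE lj]; last first.
  by rewrite eq_sym lj mulr0.
rewrite big1 ?addr0 1?mulrC // => k /negbTE ki; rewrite big1 // => l _.
by rewrite [i == k]eq_sym ki andbF mulr0.
Qed.

End Completeness.

(** * Summing the correlator over all labels, for two fixed bases *)

Section Correlator.
Context (E F : T -> 'M[C]_d).
Context (hE : hermitian_basis E) (hF : hermitian_basis F) (d_gt0 : (0 < d)%N).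
Context (E_mul : forall p q, exists r c, E p *m E q = c *: E r).

Let q : C := d%:R ^+ 2.

Let d_neq0 : d%:R != 0 :> C. Proof. by rewrite pnatr_eq0 -lt0n. Qed.

(** The product P of the outline. *)
Definition basis_prod k (A : {ffun 'I_k -> T}) : 'M[C]_d := \prod_(j < k) E (A j).

(** The word Y of the outline, with [F] as the evolved basis. *)
Definition mixed_prod k (A B : {ffun 'I_k -> T}) : 'M[C]_d :=
  \prod_(j < k) (E (A j) *m F (B j)).

Lemma basis_prod_snoc k (A : {ffun 'I_k -> T}) a :
  basis_prod (ffun_snoc A a) = basis_prod A *m E a.
Proof.
rewrite /basis_prod big_ord_recr ffun_snoc_max; congr (_ *m _).
by apply: eq_bigr => j _; rewrite ffun_snoc_widen.
Qed.

Lemma mixed_prod_snoc k (A B : {ffun 'I_k -> T}) a b :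
  mixed_prod (ffun_snoc A a) (ffun_snoc B b) = mixed_prod A B *m (E a *m F b).
Proof.
rewrite /mixed_prod big_ord_recr !ffun_snoc_max; congr (_ *m _).
by apply: eq_bigr => j _; rewrite !ffun_snoc_widen.
Qed.

Lemma basis_prod_unitary k (A : {ffun 'I_k -> T}) : basis_prod A \is unitarymx.
Proof. by apply: prod_unitarymx => j; exact: (hb_unitary hE). Qed.

Lemma mixed_prod_unitary k (A B : {ffun 'I_k -> T}) : mixed_prod A B \is unitarymx.
Proof.
apply: prod_unitarymx => j; apply: mul_unitarymx.
  exact: (hb_unitary hE).
exact: (hb_unitary hF).
Qed.

Lemma unitary_trace_mul_adj (X : 'M[C]_d) : X \is unitarymx -> \tr (X *m X^t*) = d%:R.
Proof. by move=> /unitarymxP ->; rewrite mxtrace1. Qed.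

(** By cyclicity the trace is the coefficient of a unitary [Z] along [F b]. Parseval over all [b]
    gives q; the term at [e] is then subtracted, and there the two copies of [E a] cancel. *)
Lemma sum_nonid_overlap (Y P : 'M[C]_d) a :
  Y \is unitarymx -> P \is unitarymx ->
  \sum_(b | b != e) \tr (Y *m (E a *m F b) *m (P *m E a)^t*)
      * (\tr (Y *m (E a *m F b) *m (P *m E a)^t*))^*
  = q - \tr (Y *m P^t*) * (\tr (Y *m P^t*))^*.
Proof.
move=> uY uP; pose Z := E a *m P^t* *m Y *m E a.
have trZ b : \tr (Y *m (E a *m F b) *m (P *m E a)^t*) = \tr (Z *m F b).
  by rewrite adjmx_mul (hb_herm hE) [in LHS]mxtrace_mulC !mulmxA.
under eq_bigr do rewrite trZ.
have uZ : Z \is unitarymx.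
  by rewrite !mul_unitarymx ?(hb_unitary hE) // trmxC_unitary.
have := hb_parseval hF d_gt0 Z; rewrite (bigD1 e) //= unitary_trace_mul_adj //.
have -> : \tr (Z *m F e) = \tr (Y *m P^t*).
  rewrite (hb_id hF) mulmx1 /Z mxtrace_mulC !mulmxA (hb_inv hE) mul1mx.
  exact: mxtrace_mulC.
by rewrite /q expr2 => <-; rewrite addrC addrK.
Qed.

(** The N_k of the outline, kept as a sum of ones so that it combines termwise with
    [overlap_sum]. *)
Definition count_nonid k : C :=
  \sum_(A : {ffun 'I_k -> T}) \sum_(B : {ffun 'I_k -> T} | [forall j, B j != e]) 1.

(** The S_k of the outline. *)
Definition overlap_sum k : C :=
  \sum_(A : {ffun 'I_k -> T}) \sum_(B : {ffun 'I_k -> T} | [forall j, B j != e])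
    \tr (mixed_prod A B *m (basis_prod A)^t*)
    * (\tr (mixed_prod A B *m (basis_prod A)^t*))^*.

Lemma sum_ffun0 (V : nmodType) (f : {ffun 'I_0 -> T} -> V) (P : pred {ffun 'I_0 -> T}) :
  (forall A, P A) -> \sum_(A | P A) f A = f [ffun=> e].
Proof.
move=> hP; rewrite (bigD1 [ffun=> e]) //= big1 ?addr0 // => A /andP[_ /eqP []].
by apply/ffunP => -[].
Qed.

Lemma sum1_labels : \sum_(a : T) 1 = q.
Proof. by rewrite sumr_const (hb_card hE) natrM. Qed.

Lemma sum1_nonid : \sum_(b : T | b != e) 1 = q - 1.
Proof. by rewrite -sum1_labels [in RHS](bigD1 e) //= addrC addrK. Qed.

(** The last pair of labels becomes innermost, so it can be summed with the first k pairs held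
    fixed. *)
Lemma sum_snoc k (f : {ffun 'I_k.+1 -> T} -> {ffun 'I_k.+1 -> T} -> C) :
  \sum_A \sum_(B : {ffun 'I_k.+1 -> T} | [forall j, B j != e]) f A B
  = \sum_A \sum_(B : {ffun 'I_k -> T} | [forall j, B j != e])
      \sum_a \sum_(b | b != e) f (ffun_snoc A a) (ffun_snoc B b).
Proof.
rewrite big_ffun_snoc; apply: eq_bigr => A _.
rewrite [RHS]exchange_big /=; apply: eq_bigr => a _.
exact: (big_ffun_snoc_cond (fun b => b != e)).
Qed.

Lemma count_nonidE k : count_nonid k = q ^+ k * (q - 1) ^+ k.
Proof.
elim: k => [|k IH].
  rewrite /count_nonid sum_ffun0 // sum_ffun0 ?mulr1 // => B.
  by apply/forallP => -[].
rewrite /count_nonid sum_snoc.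
under eq_bigr do under eq_bigr do under eq_bigr do rewrite sum1_nonid.
transitivity (count_nonid k * (q * (q - 1))); last by rewrite IH !exprS mulrC mulrACA.
rewrite /count_nonid mulr_suml; apply: eq_bigr => A _.
rewrite mulr_suml; apply: eq_bigr => B _.
by rewrite mul1r -sum1_labels mulr_suml; under [RHS]eq_bigr do rewrite mul1r.
Qed.

(** Dividing S_k by q^k turns the recursion into s_(k+1) = q (q - 1)^k - s_k. A particular solution
    is (q - 1)^k, and the alternating term is fixed by S_0 = q. *)
Lemma overlap_sumE k :
  overlap_sum k = q ^+ k * ((q - 1) ^+ k + (-1) ^+ k * (q - 1)).
Proof.
elim: k => [|k IH].
  rewrite /overlap_sum sum_ffun0 // sum_ffun0; last by move=> B; apply/forallP => -[].
  rewrite /mixed_prod /basis_prod !big_ord0 trmx1 map_mx1 mul1mx mxtrace1.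
  by rewrite conjC_nat !expr0 !mul1r addrC subrK /q expr2.
rewrite /overlap_sum sum_snoc.
transitivity (q * (q * count_nonid k - overlap_sum k)); last first.
  rewrite IH count_nonidE !exprS.
  rewrite mulrCA -mulrBr -mulrA; congr (_ * _).
  set x := (q - 1) ^+ k; set y := (-1) ^+ k.
  rewrite mulN1r mulNr opprD addrA; congr (_ * (_ + _)).
  by rewrite mulrBl mul1r.
rewrite /count_nonid /overlap_sum mulr_sumr -sumrB mulr_sumr; apply: eq_bigr => A _.
rewrite mulr_sumr -sumrB mulr_sumr; apply: eq_bigr => B _.
(* The sum over [b] turns out independent of [a], so the free label [a] accounts for the outer
   factor q. *)
rewrite mulr1 -[X in X * _]sum1_labels mulr_suml; apply: eq_bigr => a _; rewrite mul1r.
under eq_bigr do rewrite mixed_prod_snoc basis_prod_snoc.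
by rewrite sum_nonid_overlap ?mixed_prod_unitary ?basis_prod_unitary.
Qed.

(** Closure under products makes P a phase times one basis element [E r]. Hence exactly one last
    label, [r], turns the full product into a scalar. *)
Lemma basis_prod_inverse k (A : {ffun 'I_k -> T}) :
  exists a0 c, [/\ c * c^* = 1, E a0 = c *: (basis_prod A)^t*
    & forall a, is_scalar_mx (basis_prod A *m E a) = (a == a0)].
Proof.
have [r [c PE]] : exists r c, basis_prod A = c *: E r.
  rewrite /basis_prod; elim/big_ind: _ => [|X Y [r [c ->]] [s [b ->]]|i _].
  - by exists e, 1; rewrite scale1r (hb_id hE).
  - have [t [x rs]] := E_mul r s; exists t, (c * b * x).
    transitivity ((c *: E r) *m (b *: E s)) => //.
    by rewrite -scalemxAl -scalemxAr rs !scalerA.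
  - by exists (A i), 1; rewrite scale1r.
have uP := basis_prod_unitary A.
have cc : c * c^* = 1.
  have := unitary_trace_mul_adj uP.
  rewrite PE linearZ /= map_mxZ (hb_herm hE) -scalemxAl -scalemxAr scalerA.
  rewrite (hb_inv hE) linearZ /= mxtrace1 => /(congr1 (fun x => x / d%:R)).
  by rewrite mulfK // divff.
exists r, c; split=> // [|a].
  by rewrite PE linearZ /= map_mxZ (hb_herm hE) scalerA cc scale1r.
apply/idP/eqP => [/is_scalar_mxP [s Ps]|->]; last first.
  by rewrite PE -scalemxAl (hb_inv hE) scalemx1 scalar_mx_is_scalar.
apply/eqP; apply: contraT => ar.
(* For a label other than [r] the product is traceless, so as a scalar it would vanish,
   contradicting unitarity. *)
have s0 : s = 0.
  have /eqP := congr1 (@mxtrace _ _) Ps.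
  rewrite PE -scalemxAl linearZ /= (hb_orth hE) [r == a]eq_sym (negbTE ar) mulr0n mulr0.
  by rewrite mxtrace_scalar eq_sym mulrn_eq0 eqn0Ngt d_gt0 => /eqP.
have := unitary_trace_mul_adj (mul_unitarymx uP (hb_unitary hE a)).
by rewrite Ps s0 raddf0 mul0mx mxtrace0 => /eqP; rewrite eq_sym (negbTE d_neq0).
Qed.

(** The word of [oto_word] with the evolved operators already inserted; for fixed U the two agree by
    unfolding. *)
Definition otoc_word m (A B : 'I_m.+1 -> 'M[C]_d) : 'M[C]_d :=
  (\prod_(j < m.+1) (A j *m B j)) *m (A ord_max)^t*
  *m (\prod_(j < m) (let k := widen_ord (leqnSn m) (rev_ord j) in
                     (B k)^t* *m (A k)^t*))
  *m (B ord_max)^t*.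

(** With X the word Y followed by the last A, the correlator collapses to a four-point one: X, the
    last evolved B, the adjoint of X, and that B again. *)
Lemma otoc_word_snoc m (A B : {ffun 'I_m -> T}) a b :
  otoc_word (E \o ffun_snoc A a) (F \o ffun_snoc B b)
  = (mixed_prod A B *m E a) *m F b *m (mixed_prod A B *m E a)^t* *m F b.
Proof.
rewrite /otoc_word [X in X *m _ *m _ *m _](mixed_prod_snoc A B a b) /=.
rewrite !ffun_snoc_max (hb_herm hE) (hb_herm hF) adjmx_mul (hb_herm hE).
rewrite -prod_adjmx_rev !mulmxA; congr (_ *m _ *m _).
by apply: eq_bigr => j _; rewrite !ffun_snoc_widen adjmx_mul.
Qed.

Lemma sum_otoc_word m :
  \sum_A \sum_(B : {ffun 'I_m.+1 -> T} | [forall j, B j != e])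
     (if is_scalar_mx (basis_prod A) then 0
      else d%:R^-1 * \tr (otoc_word (E \o A) (F \o B)))
  = (-1) ^+ m.+1 * q ^+ m * (q - 1).
Proof.
rewrite sum_snoc.
(* Each choice of the first m pairs contributes 1 minus its squared overlap. *)
transitivity (count_nonid m - overlap_sum m); last first.
  rewrite overlap_sumE count_nonidE mulrDr opprD addrA subrr sub0r exprS mulN1r.
  by rewrite !mulNr mulrCA mulrA.
rewrite /count_nonid /overlap_sum -sumrB; apply: eq_bigr => A _.
rewrite -sumrB; apply: eq_bigr => B _.
have [a0 [c [cc Ea0 scalP]]] := basis_prod_inverse A.
set Y := mixed_prod A B; set P := basis_prod A in Ea0 scalP *.
pose g a b := d%:R^-1 * \tr (Y *m E a *m F b *m (Y *m E a)^t* *m F b).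
(* Twirling [F b] over the last A yields its trace, which is zero. *)
have sum_g b : b != e -> \sum_a g a b = 0.
  move=> be; rewrite /g -mulr_sumr -raddf_sum /=.
  rewrite (eq_bigr (fun a => Y *m (E a *m F b *m E a) *m (Y^t* *m F b))) => [|a _].
    rewrite -mulmx_suml -mulmx_sumr (hb_twirl hE d_gt0) (hb_trace hF be) mulr0.
    by rewrite raddf0 mulmx0 mul0mx mxtrace0 mulr0.
  by rewrite adjmx_mul (hb_herm hE) !mulmxA.
have uX : Y *m E a0 \is unitarymx.
  by rewrite mul_unitarymx ?mixed_prod_unitary ?(hb_unitary hE).
(* [E a0] is the adjoint of P up to a phase, which the squared modulus does not see. *)
have trX : \tr (Y *m E a0) * (\tr (Y *m E a0))^* = \tr (Y *m P^t*) * (\tr (Y *m P^t*))^*.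
  by rewrite Ea0 -scalemxAr linearZ /= rmorphM mulrACA cc mul1r.
(* As the sum over all [a] vanishes, dropping the excluded [a0] leaves minus its term. *)
transitivity (\sum_(b | b != e) - g a0 b).
  rewrite exchange_big; apply: eq_bigr => b be.
  transitivity (\sum_a g a b - g a0 b); last by rewrite sum_g // sub0r.
  rewrite [in RHS](bigD1 a0) //= addrAC subrr add0r.
  rewrite [LHS](bigD1 a0) //= basis_prod_snoc scalP eqxx add0r.
  apply: eq_bigr => a /negbTE ane.
  by rewrite basis_prod_snoc scalP ane otoc_word_snoc.
rewrite sumrN -trX; apply/eqP; rewrite eqr_oppLR opprB; apply/eqP.
have ge : g a0 e = 1.
  by rewrite /g (hb_id hF) !mulmx1 unitary_trace_mul_adj // mulVf.
(* Restoring [b = e], whose term is 1, permits a full twirl over [b]; that gives the squared modulus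
   of the trace of X. *)
transitivity (\sum_b g a0 b - g a0 e).
  by rewrite [in RHS](bigD1 e) //= addrAC subrr add0r.
rewrite ge; congr (_ - _); rewrite /g -mulr_sumr -raddf_sum /=.
move: (Y *m E a0) => X.
under eq_bigr do rewrite -!mulmxA.
rewrite -mulmx_sumr.
under eq_bigr do rewrite mulmxA.
rewrite (hb_twirl hF d_gt0) mul_mx_scalar linearZ /= mxtrace_adj -mulrA mulKf //.
exact: mulrC.
Qed.

(** The denominator of the average: the first m pairs are counted by N_m, then the last A avoids the
    single label [a0] and the last B avoids [e]. *)
Lemma sum_otoc_choices m :
  \sum_(A : {ffun 'I_m.+1 -> T}) \sum_(B : {ffun 'I_m.+1 -> T} | [forall j, B j != e])
     (if is_scalar_mx (basis_prod A) then 0 else 1)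
  = q ^+ m * (q - 1) ^+ m.+2.
Proof.
rewrite sum_snoc.
transitivity (count_nonid m * ((q - 1) * (q - 1))); last first.
  by rewrite count_nonidE !exprS -mulrA; congr (_ * _); rewrite mulrC !mulrA.
rewrite /count_nonid mulr_suml; apply: eq_bigr => A _.
rewrite mulr_suml; apply: eq_bigr => B _; rewrite mul1r.
have [a0 [c [_ _ scalP]]] := basis_prod_inverse A.
rewrite exchange_big /= -[X in X * _]sum1_nonid mulr_suml; apply: eq_bigr => b _.
rewrite mul1r (bigD1 a0) //= basis_prod_snoc scalP eqxx add0r.
rewrite -sum1_labels [in RHS](bigD1 a0) //= addrC addrK; apply: eq_bigr => a /negbTE ane.
by rewrite basis_prod_snoc scalP ane.
Qed.

End Correlator.
End HermitianBasis.

Local Open Scope classical_set_scope.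
Local Open Scope complex_scope.

(** * Integrability of the correlator *)

(** Multiplying by i preserves the modulus and moves the imaginary part, up to sign, into the real
    part. *)
Lemma normc_ge_Im (R : rcfType) (x : R[i]) : `|complex.Im x|%:C <= `|x|.
Proof.
rewrite -normrN -ReiNIm; apply: le_trans (normc_ge_Re _) _.
by rewrite normrM [X in _ * X]normc_def /= expr0n expr1n add0r sqrtr1 mulr1.
Qed.

Lemma Re_continuous (R : realType) : continuous (@complex.Re R : R[i]^o -> R).
Proof.
move=> x; apply/(@cvgrPdist_lt R R^o _ _ (nbhs_filter (x : R[i]^o))) => e e0.
apply/(@nbhs_normP _ R[i]^o); exists e%:C; first by rewrite /= ltcR.
move=> y /=; rewrite -ltcR; apply: le_lt_trans.
have -> : complex.Re x - complex.Re y = complex.Re ((x : R[i]) - y).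
  by case: x y => [a b] [c d].
exact: normc_ge_Re.
Qed.

Lemma Im_continuous (R : realType) : continuous (@complex.Im R : R[i]^o -> R).
Proof.
move=> x; apply/(@cvgrPdist_lt R R^o _ _ (nbhs_filter (x : R[i]^o))) => e e0.
apply/(@nbhs_normP _ R[i]^o); exists e%:C; first by rewrite /= ltcR.
move=> y /=; rewrite -ltcR; apply: le_lt_trans.
have -> : complex.Im x - complex.Im y = complex.Im ((x : R[i]) - y).
  by case: x y => [a b] [c d].
exact: normc_ge_Im.
Qed.

(** Open intervals generate the Borel sets of the line, and their preimages are open for the
    topology that U(d) inherits from matrices. *)
Lemma measurable_entry (R : realType) (d : nat) (g : R[i]^o -> R) i j :
  continuous g ->
  measurable_fun setT (fun U : unitary_borel R d => g (sval U i j) : R).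
Proof.
move=> cg; apply: (measurability _ (RGenOpens.measurableE R)) => //.
move=> _ [_ [a [b ->]] <-].
rewrite setTI; apply: sub_gen_smallest; rewrite /unitary_open /=.
have -> : (fun U : unitary_borel R d => g (sval U i j)) @^-1` `]a, b[%classic
    = @unitary_mx R d @^-1` ((fun M : 'M[R[i]^o]_d => M i j) @^-1` (g @^-1` `]a, b[%classic)).
  by [].
apply: open_comp; first by move=> ? _; exact: initial_continuous.
apply: open_comp; first by move=> ? _; exact: coord_continuous.
by apply: open_comp; [move=> ? _; exact: cg|exact: interval_open].
Qed.

(** * Bounded measurable complex functions *)

Section BoundedMeasurable.
Context (R : realType) (disp : measure_display) (T : measurableType disp).
Implicit Types f g : T -> R[i].

(** Unlike integrability, this condition is stable under products, and it implies integrability for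
    a probability measure. Real and imaginary parts are separate because [complex_integral] is
    defined through them. *)
Definition bounded_measurable f : Prop :=
  [/\ measurable_fun setT (fun x => complex.Re (f x)),
      measurable_fun setT (fun x => complex.Im (f x))
    & exists K : R, forall x, `|f x| <= K%:C].

Lemma bounded_measurable_cst c : bounded_measurable (fun=> c).
Proof.
split; [exact: measurable_cst|exact: measurable_cst|].
by exists (complex.Re `|c|) => x; rewrite RRe_real ?normr_real.
Qed.

Lemma bounded_measurableD f g : bounded_measurable f -> bounded_measurable g ->
  bounded_measurable (fun x => f x + g x).
Proof.
move=> [fR fI [K fK]] [gR gI [L gL]]; split.
- by under eq_fun do rewrite raddfD; exact: measurable_funD.
- by under eq_fun do rewrite raddfD; exact: measurable_funD.
- by exists (K + L) => x; rewrite rmorphD; apply: le_trans (ler_normD _ _) (lerD _ _).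
Qed.

Lemma bounded_measurableM f g : bounded_measurable f -> bounded_measurable g ->
  bounded_measurable (fun x => f x * g x).
Proof.
move=> [fR fI [K fK]] [gR gI [L gL]]; split.
- have -> : (fun x => complex.Re (f x * g x)) =
     (fun x => complex.Re (f x) * complex.Re (g x) - complex.Im (f x) * complex.Im (g x)).
    by apply/funext => x; case: (f x) (g x) => [a b] [c d].
  by apply: measurable_funB; exact: measurable_funM.
- have -> : (fun x => complex.Im (f x * g x)) =
     (fun x => complex.Re (f x) * complex.Im (g x) + complex.Im (f x) * complex.Re (g x)).
    by apply/funext => x; case: (f x) (g x) => [a b] [c d].
  by apply: measurable_funD; exact: measurable_funM.
- by exists (K * L) => x; rewrite rmorphM normrM ler_pM.
Qed.

Lemma bounded_measurable_conj f :
  bounded_measurable f -> bounded_measurable (fun x => (f x)^*)%R.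
Proof.
move=> [fR fI [K fK]]; split.
- by have -> : (fun x => complex.Re ((f x)^*)%R) = (fun x => complex.Re (f x));
    first by apply/funext => x; case: (f x).
- have -> : (fun x => complex.Im ((f x)^*)%R) = (fun x => - complex.Im (f x)).
    by apply/funext => x; case: (f x).
  exact: measurableT_comp.
- by exists K => x; move: (fK x); rewrite -(norm_conjC (f x)).
Qed.

Lemma bounded_measurable_sum (I : Type) (s : seq I) (P : pred I) (F : I -> T -> R[i]) :
  (forall i, P i -> bounded_measurable (F i)) ->
  bounded_measurable (fun x => \sum_(i <- s | P i) F i x).
Proof.
move=> hF; elim: s => [|i s IH].
  by under eq_fun do rewrite big_nil; exact: bounded_measurable_cst.
under eq_fun do rewrite big_cons; case: (boolP (P i)) => // Pi.
by apply: bounded_measurableD => //; exact: hF.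
Qed.

Lemma bounded_measurable_integrable f (mu : probability T R) :
  bounded_measurable f ->
  mu.-integrable setT (EFin \o (fun x => complex.Re (f x))) /\
  mu.-integrable setT (EFin \o (fun x => complex.Im (f x))).
Proof.
move=> [fR fI [K fK]].
have muT : (mu setT < +oo)%E by rewrite probability_setT ltry.
split; apply: measurable_bounded_integrable => //.
- exists K; split=> [|L KL x _] /=; first exact: num_real.
  apply: le_trans (ltW KL); rewrite -lecR.
  exact: le_trans (normc_ge_Re _) (fK x).
- exists K; split=> [|L KL x _] /=; first exact: num_real.
  apply: le_trans (ltW KL); rewrite -lecR.
  exact: le_trans (normc_ge_Im _) (fK x).
Qed.

End BoundedMeasurable.

(** * The same closure properties, entrywise for matrices *)

Section BoundedMeasurableMatrix.
Context (R : realType) (disp : measure_display) (T : measurableType disp).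

Definition bounded_measurable_mx (p q : nat) (F : T -> 'M[R[i]]_(p, q)) : Prop :=
  forall i j, bounded_measurable (fun x => F x i j).

Lemma bounded_measurable_mx_cst p q (M : 'M[R[i]]_(p, q)) :
  bounded_measurable_mx (fun=> M).
Proof. by move=> i j; exact: bounded_measurable_cst. Qed.

Lemma bounded_measurable_mx_mul p q r (F : T -> 'M[R[i]]_(p, q))
    (G : T -> 'M[R[i]]_(q, r)) :
  bounded_measurable_mx F -> bounded_measurable_mx G ->
  bounded_measurable_mx (fun x => F x *m G x).
Proof.
move=> mF mG i j; under eq_fun do rewrite mxE.
by apply: bounded_measurable_sum => k _; apply: bounded_measurableM.
Qed.

Lemma bounded_measurable_mx_adj p q (F : T -> 'M[R[i]]_(p, q)) :
  bounded_measurable_mx F -> bounded_measurable_mx (fun x => (F x)^t*).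
Proof.
by move=> mF i j; under eq_fun do rewrite !mxE; exact: bounded_measurable_conj.
Qed.

Lemma bounded_measurable_mx_prod d (I : Type) (s : seq I) (F : I -> T -> 'M[R[i]]_d) :
  (forall i, bounded_measurable_mx (F i)) ->
  bounded_measurable_mx (fun x => \prod_(i <- s) F i x).
Proof.
move=> mF; elim: s => [|i s IH].
  by under eq_fun do rewrite big_nil; exact: bounded_measurable_mx_cst.
by under eq_fun do rewrite big_cons; exact: bounded_measurable_mx_mul.
Qed.

Lemma bounded_measurable_trace d (F : T -> 'M[R[i]]_d) :
  bounded_measurable_mx F -> bounded_measurable (fun x => \tr (F x)).
Proof. by move=> mF; apply: bounded_measurable_sum => i _; exact: mF. Qed.

End BoundedMeasurableMatrix.

(** Every row has squared norm 1, a sum of nonnegative terms that contains the given one. *)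
Lemma unitary_entry_le1 (C : numClosedFieldType) d (U : 'M[C]_d) i j :
  U \is unitarymx -> `|U i j| <= 1.
Proof.
move=> /unitarymxP/matrixP/(_ i i); rewrite !mxE eqxx => U1.
rewrite -(@ler_pXn2r _ 2) ?nnegrE // expr1n.
rewrite -[leRHS]/(true%:R) -U1 (bigD1 j) //= !mxE -normCK lerDl.
apply: sumr_ge0 => k _; rewrite !mxE.
exact: mul_conjC_ge0.
Qed.

(** * Integrating the correlator over the unitary group *)

Section HaarIntegral.
Context (R : realType) (d : nat).

Lemma bounded_measurable_unitary :
  bounded_measurable_mx (fun U : unitary_borel R d => sval U).
Proof.
move=> i j; split.
- exact: (measurable_entry _ _ (@Re_continuous R)).
- exact: (measurable_entry _ _ (@Im_continuous R)).
- by exists 1 => U; exact: (unitary_entry_le1 i j (svalP U)).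
Qed.

Lemma bounded_measurable_evolve (B : 'M[R[i]]_d) :
  bounded_measurable_mx (fun U : unitary_borel R d => evolve U B).
Proof.
have mU := bounded_measurable_unitary; rewrite /evolve.
apply: bounded_measurable_mx_mul (mU); apply: bounded_measurable_mx_mul.
  exact: bounded_measurable_mx_adj.
exact: bounded_measurable_mx_cst.
Qed.

Lemma bounded_measurable_oto_word m (A B : 'I_m.+1 -> 'M[R[i]]_d) :
  bounded_measurable_mx (fun U : unitary_borel R d => oto_word A B U).
Proof.
rewrite /oto_word /=.
apply: bounded_measurable_mx_mul; last first.
  exact/bounded_measurable_mx_adj/bounded_measurable_evolve.
apply: bounded_measurable_mx_mul; last first.
  apply: bounded_measurable_mx_prod => i.
  apply: bounded_measurable_mx_mul; last exact: bounded_measurable_mx_cst.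
  exact/bounded_measurable_mx_adj/bounded_measurable_evolve.
apply: bounded_measurable_mx_mul; last exact: bounded_measurable_mx_cst.
apply: bounded_measurable_mx_prod => i; apply: bounded_measurable_mx_mul.
  exact: bounded_measurable_mx_cst.
exact: bounded_measurable_evolve.
Qed.

Variable mu : probability (unitary_borel R d) R.

Lemma complex_integral_cst c : complex_integral mu (fun=> c) = c.
Proof.
rewrite /complex_integral !Rintegral_cst //.
rewrite (_ : fine _ = 1) ?mulr1; first by case: c.
by rewrite -[RHS]/(fine 1%:E); congr fine; exact: probability_setT.
Qed.

(** Brings the sum over Pauli choices under the integral; boundedness supplies the integrability
    that each addition requires. *)
Lemma complex_integral_sum (I : Type) (s : seq I) (P : pred I)
    (F : I -> unitary_borel R d -> R[i]) :
  (forall i, P i -> bounded_measurable (F i)) ->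
  \sum_(i <- s | P i) complex_integral mu (F i)
  = complex_integral mu (fun U => \sum_(i <- s | P i) F i U).
Proof.
move=> mF; elim: s => [|i s IH].
  rewrite big_nil -[LHS](complex_integral_cst 0); congr complex_integral.
  by apply/funext => U; rewrite big_nil.
rewrite big_cons; under [in RHS]eq_fun do rewrite big_cons.
case: (boolP (P i)) => // Pi; rewrite {}IH.
have [iR iI] := bounded_measurable_integrable mu (mF _ Pi).
have [sR sI] := bounded_measurable_integrable mu
  (bounded_measurable_sum s mF).
rewrite /complex_integral.
under [X in _ = X +i* _]eq_Rintegral do rewrite raddfD.
under [X in _ = _ +i* X]eq_Rintegral do rewrite raddfD.
by rewrite !RintegralD.
Qed.

End HaarIntegral.

(** * Pauli operators *)

Section Tensor.
Context (R : realType).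
Local Notation C := R[i].

Lemma tensmx_id m n : (1%:M : 'M[C]_m) *t (1%:M : 'M[C]_n) = 1%:M.
Proof.
apply/matrixP=> i j; case: (mxtens_indexP i) => i0 i1.
case: (mxtens_indexP j) => j0 j1.
by rewrite tensmxE !mxE (can_eq (@mxtens_indexK _ _)) xpair_eqE -mulnb natrM.
Qed.

Lemma mxtrace_tens m n (M : 'M[C]_m) (N : 'M[C]_n) :
  \tr (M *t N) = \tr M * \tr N.
Proof. by rewrite mulr_sum; apply: eq_bigr => i _; rewrite mxE. Qed.

Lemma adjmx_tens m n (M : 'M[C]_m) (N : 'M[C]_n) : (M *t N)^t* = M^t* *t N^t*.
Proof. by rewrite trmx_tens map_mxT. Qed.

Lemma tensmx_scale m n a b (M : 'M[C]_m) (N : 'M[C]_n) :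
  (a *: M) *t (b *: N) = (a * b) *: (M *t N).
Proof. by apply/matrixP => i j; rewrite !mxE mulrACA. Qed.

(** [tensor] inserts a size cast at every factor; this and the following lemmas push it through the
    matrix operations. *)
Lemma castmx_mulmx m n (eq_mn : m = n) (M N : 'M[C]_m) :
  castmx (eq_mn, eq_mn) M *m castmx (eq_mn, eq_mn) N
  = castmx (eq_mn, eq_mn) (M *m N).
Proof. by case: n / eq_mn. Qed.

Lemma adjmx_cast m n (eq_mn : m = n) (M : 'M[C]_m) :
  (castmx (eq_mn, eq_mn) M)^t* = castmx (eq_mn, eq_mn) (M^t*).
Proof. by case: n / eq_mn. Qed.

Lemma mxtrace_cast m n (eq_mn : m = n) (M : 'M[C]_m) :
  \tr (castmx (eq_mn, eq_mn) M) = \tr M.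
Proof. by case: n / eq_mn. Qed.

Lemma castmx_scale m n (eq_mn : m = n) a (M : 'M[C]_m) :
  castmx (eq_mn, eq_mn) (a *: M) = a *: castmx (eq_mn, eq_mn) M.
Proof. by case: n / eq_mn. Qed.

Lemma castmx_scalar1 m n (eq_mn : m = n) :
  castmx (eq_mn, eq_mn) 1%:M = 1%:M :> 'M[C]_n.
Proof. by case: n / eq_mn. Qed.

Lemma tensor_id n : tensor (fun _ : 'I_n => 1%:M : 'M[C]_2) = 1%:M.
Proof.
by elim: n => [|n IH] //=; rewrite IH tensmx_id castmx_scalar1.
Qed.

Lemma tensor_mul n (M N : 'I_n -> 'M[C]_2) :
  tensor M *m tensor N = tensor (fun j => M j *m N j).
Proof.
elim: n M N => [|n IH] M N /=; first by rewrite mul1mx.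
by rewrite castmx_mulmx tensmx_mul IH.
Qed.

Lemma tensor_adj n (M : 'I_n -> 'M[C]_2) :
  (tensor M)^t* = tensor (fun j => (M j)^t*).
Proof.
elim: n M => [|n IH] M /=; first by rewrite trmx1 map_mx1.
by rewrite adjmx_cast adjmx_tens IH.
Qed.

Lemma mxtrace_tensor n (M : 'I_n -> 'M[C]_2) :
  \tr (tensor M) = \prod_(j < n) \tr (M j).
Proof.
elim: n M => [|n IH] M /=; first by rewrite big_ord0 mxtrace1.
by rewrite mxtrace_cast mxtrace_tens IH big_ord_recl.
Qed.

Lemma tensor_scale n (c : 'I_n -> C) (M : 'I_n -> 'M[C]_2) :
  tensor (fun j => c j *: M j) = (\prod_(j < n) c j) *: tensor M.
Proof.
elim: n c M => [|n IH] c M /=; first by rewrite big_ord0 scale1r.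
by rewrite IH tensmx_scale castmx_scale big_ord_recl.
Qed.

End Tensor.

(** * Pauli operators form a Hermitian basis *)

Section PauliBasis.
Context (R : realType).
Local Notation C := R[i].

Lemma pauli1_id : pauli1 R ord0 = 1%:M.
Proof. by rewrite /pauli1 (tnth_nth 0). Qed.

(* 1, 2, 3 are X, Y, Z; two distinct ones multiply to the third, 6 - a - b. *)
Definition pauli1_prod (a b : 'I_4) : 'I_4 :=
  inord (if a == b then 0 else if a == ord0 then b : nat
         else if b == ord0 then a : nat else 6 - a - b)%N.

(** The cyclic rule XY = iZ, YZ = iX, ZX = iY: the first test catches XY and YZ, the second ZX;
    reversed orders give -i. *)
Definition pauli1_phase (a b : 'I_4) : C :=
  if [|| a == ord0, b == ord0 | a == b] then 1
  else if (b == a + 1 :> nat)%N || (a == b + 2 :> nat)%N then 'i else - 'i.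

(** A table of entries that reduces the single-qubit identities to finite case checks. *)
Lemma pauli1_entry (k : 'I_4) (i j : 'I_2) :
  pauli1 R k i j =
   match val k, val i, val j with
   | 0%N, 0%N, 0%N | 0%N, 1%N, 1%N | 1%N, 0%N, 1%N | 1%N, 1%N, 0%N
   | 3%N, 0%N, 0%N => 1
   | 3%N, 1%N, 1%N => -1 | 2%N, 0%N, 1%N => - 'i | 2%N, 1%N, 0%N => 'i
   | _, _, _ => 0 end.
Proof.
case: k => -[|[|[|[|//]]]] ?; rewrite /pauli1 (tnth_nth 0) /=;
case: i => -[|[|//]] ?; case: j => -[|[|//]] ?; rewrite !mxE /= ?mulr0n ?mulr1n ?expr0 ?expr1 //.
by apply/eqP; rewrite eq_complex /= oppr0 !eqxx.
Qed.

Lemma conj_i : (('i%C : C)^*)%R = - 'i%C.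
Proof. by apply/eqP; rewrite eq_complex /= oppr0 !eqxx. Qed.

Lemma conj_opp_i : ((- 'i%C : C)^*)%R = 'i%C.
Proof. by apply/eqP; rewrite eq_complex /= oppr0 opprK !eqxx. Qed.

Lemma pauli1_herm k : (pauli1 R k)^t* = pauli1 R k.
Proof.
apply/matrixP => i j; rewrite !mxE !pauli1_entry.
case: k => -[|[|[|[|//]]]] ? /=; case: i => -[|[|//]] ?; case: j => -[|[|//]] ? /=;
by rewrite ?(conj_i, conj_opp_i) ?rmorphN ?rmorph1 ?rmorph0.
Qed.

Lemma pauli1_mul a b :
  pauli1 R a *m pauli1 R b = pauli1_phase a b *: pauli1 R (pauli1_prod a b).
Proof.
have ii : 'i * 'i = -1 :> C by rewrite -expr2 sqr_i.
apply/matrixP => i j; rewrite !mxE !big_ord_recl big_ord0 !pauli1_entry /pauli1_prod.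
rewrite /pauli1_phase.
case: a => -[|[|[|[|//]]]] ?; case: b => -[|[|[|[|//]]]] ? /=;
rewrite inordK //=;
case: i => -[|[|//]] ?; case: j => -[|[|//]] ? //=;
by rewrite ?(mulr0, mul0r, addr0, add0r, mulr1, mul1r, mulNr, mulrN, ii, opprK, oppr0).
Qed.

Lemma mxtrace_pauli1 k : \tr (pauli1 R k) = 2%:R *+ (k == ord0).
Proof.
rewrite /mxtrace !big_ord_recl big_ord0 !pauli1_entry.
by case: k => -[|[|[|[|//]]]] ? /=; rewrite ?addr0 ?subrr.
Qed.

Lemma pauli1_prod_eq0 a b : (pauli1_prod a b == ord0) = (a == b).
Proof.
by case: a => -[|[|[|[|//]]]] ?; case: b => -[|[|[|[|//]]]] ?;
  rewrite -val_eqE /pauli1_prod /= inordK.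
Qed.

Lemma pauli1_inv a : pauli1 R a *m pauli1 R a = 1%:M.
Proof.
rewrite pauli1_mul /pauli1_phase eqxx !orbT scale1r.
by have /eqP -> : pauli1_prod a a == ord0 by [rewrite pauli1_prod_eq0]; rewrite pauli1_id.
Qed.

Lemma pauli1_orth a b : \tr (pauli1 R a *m pauli1 R b) = 2%:R *+ (a == b).
Proof.
have [<-|ab] := eqVneq a b; first by rewrite pauli1_inv mxtrace1.
by rewrite pauli1_mul linearZ /= mxtrace_pauli1 pauli1_prod_eq0 (negbTE ab) mulr0.
Qed.

Context (n : nat).

Lemma pauli_mul (p q : {ffun 'I_n -> 'I_4}) :
  exists r c, pauli R p *m pauli R q = c *: pauli R r.
Proof.
exists [ffun j => pauli1_prod (p j) (q j)], (\prod_j pauli1_phase (p j) (q j)).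
rewrite /pauli tensor_mul -tensor_scale; congr tensor; apply/funext => j.
by rewrite pauli1_mul ffunE.
Qed.

Lemma pauli_hermitian_basis :
  hermitian_basis [ffun=> ord0] (@pauli R n).
Proof.
split.
- by rewrite card_ffun !card_ord -expnMn.
- rewrite -(tensor_id R n); congr tensor; apply/funext => j.
  by rewrite ffunE pauli1_id.
- move=> p; rewrite /pauli tensor_adj; congr tensor; apply/funext => j.
  exact: pauli1_herm.
- move=> p; rewrite /pauli tensor_mul -(tensor_id R n); congr tensor.
  by apply/funext => j; exact: pauli1_inv.
- move=> p q; rewrite /pauli tensor_mul mxtrace_tensor.
  under eq_bigr do rewrite pauli1_orth.
  have [->|pq] := eqVneq p q.
    under eq_bigr do rewrite eqxx.
    by rewrite prodr_const card_ord natrX.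
  (* Distinct labels differ at some qubit, whose trace factor vanishes. *)
  have [j pqj] : exists j, p j != q j.
    by apply/existsP; apply: contraNT pq; rewrite negb_exists => /forallP pq;
      apply/eqP/ffunP => j; apply/eqP; have := pq j; rewrite negbK.
  by rewrite (bigD1 j) //= (negbTE pqj) mul0r.
Qed.

(** Every other Pauli operator is traceless while the identity is not; conditions on operators thus
    become conditions on labels. *)
Lemma pauli_eq1 (p : {ffun 'I_n -> 'I_4}) :
  (pauli R p == 1%:M) = (p == [ffun=> ord0]).
Proof.
have hE := pauli_hermitian_basis.
apply/eqP/eqP => [p1|->]; last exact: hb_id hE.
apply/eqP; apply: contraT => /(hb_trace hE); rewrite p1 mxtrace1 => /eqP.
by rewrite pnatr_eq0 expn_eq0.
Qed.

(** Conjugation by a unitary preserves products, adjoints and traces. *)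
Lemma evolve_hermitian_basis (E : {ffun 'I_n -> 'I_4} -> 'M[C]_(2 ^ n)) e U :
  hermitian_basis e E -> hermitian_basis e (fun p => evolve U (E p)).
Proof.
move=> hE; have UU : sval U *m (sval U)^t* = 1%:M by apply/unitarymxP; exact: (svalP U).
have U'U := mulmx1C UU.
have evM X Y : evolve U X *m evolve U Y = evolve U (X *m Y).
  by rewrite /evolve !mulmxA -[_ *m sval U *m _]mulmxA UU mulmx1.
have ev1 : evolve U 1%:M = 1%:M by rewrite /evolve mulmx1.
split=> [|||p|p p']; first exact: hb_card hE.
- by rewrite (hb_id hE).
- by move=> p; rewrite /evolve !adjmx_mul trmxCK (hb_herm hE) mulmxA.
- by rewrite evM (hb_inv hE).
- by rewrite evM /evolve mxtrace_mulC mulmxA UU mul1mx (hb_orth hE).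
Qed.
End PauliBasis.

(** Excluded families A receive the summand 0 instead of a side condition, so each A label still
    ranges freely and can be twirled. *)
Lemma sum_admissible (R : realType) n M (Phi : pauli_choice n M -> R[i]) :
  \sum_(x in admissible R n M) Phi x
  = \sum_A \sum_(B : {ffun 'I_M -> {ffun 'I_n -> 'I_4}}
                  | [forall j, B j != [ffun=> ord0]])
      (if is_scalar_mx (basis_prod (@pauli R n) A) then 0 else Phi (A, B)).
Proof.
under [RHS]eq_bigr do rewrite big_mkcond.
rewrite pair_bigA big_mkcond /=; apply: eq_bigr => -[A B] _ /=; rewrite inE /=.
have -> : [forall j, pauli R (B j) != 1%:M] = [forall j, B j != [ffun=> ord0]].
  by apply: eq_forallb => j; rewrite pauli_eq1.
by case: [forall _, _] => //=; rewrite -/(basis_prod _ A); case: is_scalar_mx.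
Qed.

Theorem mainTheorem10 (R : realType) (n m : nat)
    (mu : probability (unitary_borel R (2 ^ n)) R) :
  (0 < n)%N -> is_haar mu ->
  average (admissible R n m.+1)
    (fun AB => OTO mu (fun j => pauli R (AB.1 j)) (fun j => pauli R (AB.2 j)))
  = (- 1 / (((2 ^ n)%:R : complex R) ^+ 2 - 1)) ^+ m.+1.
Proof.
move=> n_gt0 _; set q : R[i] := (2 ^ n)%:R ^+ 2.
have d_gt0 : (0 < 2 ^ n)%N by rewrite expn_gt0.
have hE := pauli_hermitian_basis R n.
rewrite /average /OTO /haar_avg complex_integral_sum => [|AB _]; last first.
  apply: bounded_measurableM; first exact: bounded_measurable_cst.
  exact/bounded_measurable_trace/bounded_measurable_oto_word.
(* The summed integrand takes the same value at every U, so it integrates as a constant. *)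
have sumE U : \sum_(AB in admissible R n m.+1) (2 ^ n)%:R^-1
      * \tr (oto_word (fun j => pauli R (AB.1 j)) (fun j => pauli R (AB.2 j)) U)
    = (-1) ^+ m.+1 * q ^+ m * (q - 1).
  rewrite sum_admissible.
  exact: (sum_otoc_word hE (evolve_hermitian_basis U hE) d_gt0 (@pauli_mul R n)).
under eq_fun do rewrite sumE.
rewrite complex_integral_cst.
have -> : #|admissible R n m.+1|%:R = q ^+ m * (q - 1) ^+ m.+2.
  rewrite -sum1_card natr_sum sum_admissible.
  exact: (sum_otoc_choices hE d_gt0 (@pauli_mul R n)).
have q0 : q != 0 by rewrite expf_neq0 // pnatr_eq0 -lt0n.
(* Here q = 4^n exceeds 1 because n is positive. *)
have q1 : q - 1 != 0.
  rewrite subr_eq0 /q -natrX (eqr_nat _ _ 1) -expnM neq_ltn orbC.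
  by rewrite -[X in (X < _)%N](expn0 2) ltn_exp2l // muln_gt0 n_gt0.
(* The factor q^m (q - 1) common to sum and count cancels. *)
rewrite expr_div_n [(q - 1) ^+ m.+2]exprSr -[X in X / _]mulrA.
rewrite [q ^+ m * (_ * _)]mulrCA -mulf_div divff ?mulr1 //.
by rewrite mulf_neq0 // expf_neq0.
Qed.
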